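(* Let $F$ and $G$ be two fixed distribution functions. For any $z\in(-\infty,\infty)$: (i) There exists a copula $C_r$, dependent only on the value $r$ of $\rho_W(F,G)(z)$, such that $$\sigma_{C_r}(F,G)(z)=\rho_W(F,G)(z)=r.$$ In other words, the upper bound on $P(X+Y\le z)$ is always achievable. (ii) We have $\rho_W(F,G)(z-)=\sup_C\sigma_C(F,G)(z-)$, where the supremum is taken over all copulas $C$. In other words, $r^*=\rho_W(F,G)(z-)$ is the supremum of $P(X+Y<z)$ over all possible joint distributions of $X,Y$ with margins $F,G$. (iii) If $r^*=\rho_W(F,G)(z-)<r=\rho_W(F,G)(z)$, then there exists a copula $C_{r^*}$, dependent only on $r^*$, such that $$\sigma_{C_{r^*}}(F,G)(z-)=\rho_W(F,G)(z-).$$ That is, the upper bound on $P(X+Y<z)$ can be achieved by $C_{r^*}$ when $\rho_W(F,G)(z-)<\rho_W(F,G)(z)$. We also have $\rho_W(F,G)(z)=\max_C\sigma_C(F,G)(z)$, where the maximum is taken over all copulas. (iv) If there is no copula $C^*$ such that $\sigma_{C^*}(F,G)(z-)=\rho_W(F,G)(z-)$, then $\rho_W(F,G)(z)=\rho_W(F,G)(z-)$. That is, if the upper bound on $P(X+Y<z)$ is not achievable by any joint distribution, then the upper bounds for $P(X+Y\le z)$ and $P(X+Y<z)$ must be the same.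
   Context: Distribution functions are right-continuous: $F(x)=P(X\le x)$, $G(y)=P(Y\le y)$, where $X,Y$ are real random variables with fixed margins $F,G$ and unspecified joint distribution. For a function $f$ of a real variable, $f(z-)$ denotes its left-hand limit at $z$. A (two-dimensional) copula is a function $C:[0,1]^2\to[0,1]$ with $C(a,0)=C(0,a)=0$, $C(a,1)=C(1,a)=a$ for all $a\in[0,1]$, and $C(a_2,b_2)-C(a_1,b_2)-C(a_2,b_1)+C(a_1,b_1)\ge 0$ whenever $a_1\le a_2$, $b_1\le b_2$ in $[0,1]$. For a copula $C$ and real $z$, $\sigma_C(F,G)(z)=\iint_{x+y\le z}dC(F(x),G(y))$, i.e. $\sigma_C(F,G)(z)=P(X+Y\le z)$ when $(X,Y)$ has joint distribution function $H(x,y)=C(F(x),G(y))$; correspondingly $\sigma_C(F,G)(z-)=P(X+Y<z)$. The Makarov upper bound is $\rho_W(F,G)(z)=\inf_{x+y=z}\min(1,F(x)+G(y))=1+\inf_{x+y=z}\min(0,F(x)+G(y)-1)$, the infimum being over real $x,y$. The upper bound on $P(X+Y\le z)$ is $\rho_W(F,G)(z)$ and the upper bound on $P(X+Y<z)$ is $\rho_W(F,G)(z-)$. ''Achievable'' means attained under some joint distribution with margins $F,G$. The copulas $C_r$ and $C_{r^*}$ are members of the family, indexed by $r\in[0,1]$, $$C_r(u,v)=\begin{cases}\max(u+v-r,0), & (u,v)\in[0,r]\times[0,r],\\ \min(u,v), & \text{otherwise.}\end{cases}$$ ''Dependent only on $r$'' means that the copula is a function of the number $r$ alone, the same for all $F,G,z$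 giving that value. *)

(* Defs.v *)
From mathcomp Require Import all_boot all_order all_algebra.
From mathcomp Require Import all_classical all_reals all_analysis.
Set Implicit Arguments.
Unset Strict Implicit.
Unset Printing Implicit Defensive.
Import Order.TTheory GRing.Theory Num.Theory.
Import numFieldNormedType.Exports.
Local Open Scope classical_set_scope.
Local Open Scope ring_scope.

(* Distribution functions on the line are the library's
   [cumulativeBounded 0 1]: nondecreasing, right-continuous, with limits 0 at
   -oo and 1 at +oo. *)

(* A copula on [0,1]^2, represented by a total function on R x R whose values
   outside the unit square are irrelevant. *)
Definition is_copula (R : realType) (C : R -> R -> R) : Prop :=
  [/\ forall u v, 0 <= u <= 1 -> 0 <= v <= 1 -> 0 <= C u v <= 1,
      forall a, 0 <= a <= 1 -> C a 0 = 0 /\ C 0 a = 0,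
      forall a, 0 <= a <= 1 -> C a 1 = a /\ C 1 a = a
    & forall a1 a2 b1 b2, 0 <= a1 -> a1 <= a2 -> a2 <= 1 ->
        0 <= b1 -> b1 <= b2 -> b2 <= 1 ->
        0 <= C a2 b2 - C a1 b2 - C a2 b1 + C a1 b1].

Definition copula_r (R : realType) (r u v : R) : R :=
  if (0 <= u <= r) && (0 <= v <= r) then Num.max (u + v - r) 0
  else Num.min u v.

(* Joint laws of pairs (X, Y): Borel probability measures on R x R. *)
Definition joint_law (R : realType) :=
  probability (measurableTypeR R * measurableTypeR R)%type R.

Definition has_joint_df (R : realType) (mu : joint_law R) (H : R -> R -> R) :
  Prop := forall x y, mu (`]-oo, x] `*` `]-oo, y]) = (H x y)%:E.

Definition has_margins (R : realType) (mu : joint_law R) (F G : R -> R) :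
  Prop :=
  (forall x, mu (`]-oo, x] `*` setT) = (F x)%:E) /\
  (forall y, mu (setT `*` `]-oo, y]) = (G y)%:E).

Definition sum_le (R : realType) (z : R) : set (R * R) :=
  [set p | p.1 + p.2 <= z].

Definition sum_lt (R : realType) (z : R) : set (R * R) :=
  [set p | p.1 + p.2 < z].

(* The number P(X + Y <= z) for (X, Y) with joint distribution function
   C(F(x), G(y)).  When C is a copula and F, G are distribution functions,
   exactly one law has this distribution function, so [xget] selects the unique
   element of a singleton; its default value 0 plays no role. *)
Definition sigma (R : realType) (C : R -> R -> R) (F G : R -> R) (z : R) : R :=
  xget 0 [set s : R | exists2 mu : joint_law R,
    has_joint_df mu (fun x y => C (F x) (G y)) & mu (sum_le z) = s%:E].

Definition rho_W (R : realType) (F G : R -> R) (z : R) : R :=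
  inf [set t : R | exists x y, x + y = z /\ t = Num.min 1 (F x + G y)].

(* f(z-) *)
Definition left_limit (R : realType) (f : R -> R) (z : R) : R :=
  lim (f x @[x --> z^'-]).

(* Main.v *)
From HB Require Import structures.
Require Import Defs.
From mathcomp Require Import all_boot all_order all_algebra.
From mathcomp Require Import all_classical all_reals all_analysis.
From mathcomp Require Import measurable_realfun lra.
Set Implicit Arguments.
Unset Strict Implicit.
Unset Printing Implicit Defensive.
Import Order.TTheory GRing.Theory Num.Theory.
Import numFieldNormedType.Exports.
Local Open Scope classical_set_scope.
Local Open Scope ring_scope.

(** The upper bounds are a union bound: for every [x], the event [X + Y <= z] is
    contained in the union of [X <= x] and [Y <= z - x], so its probability is
    at most [F x + G (z - x)] ([sum_le_rho_W]).  Letting [z] increase gives the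
    bound on [P(X + Y < z)] ([sum_lt_rho_W]).

    For attainment, the law with copula [C_r] is realized on [0,1] with the
    uniform measure: take [X = quantile F u] and [Y = quantile G (flip r u)],
    where [flip r] reflects [0,r[ onto ]0,r] and fixes the rest.  In other words
    the lower [r]-parts of the two margins are coupled antimonotonically and
    their upper parts comonotonically ([copula_r_law_joint_df]).

    When [r = rho_W F G z], every [u] in ]0,r[ satisfies
    [quantile F u + quantile G (r - u) <= z] ([quantile_sum_le]): if
    [x < quantile F u] then [F x < u], hence [G (z - x) >= r - F x > r - u], and
    right-continuity of [G] lets [x] tend to [quantile F u].  So [X + Y <= z]
    has probability at least [r].

    When [r] is the left limit and [rho_W F G] jumps by [s - r > 0] at [z], the
    same coupling yields the strict inequality except for the values [u] with
    [quantile F u + quantile G (r - u) >= z].  Such a [u] is the left limit of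
    [F] at a point where [F] jumps by at least [s - r], so these values are
    [s - r] apart ([bad_separated]), hence countable and negligible.

    Jump or not, the supremum in the second claim is approached by the laws with
    copulas [C_(rho_W F G x)] for [x] increasing to [z].

    Passing between laws and [sigma] uses that a joint distribution function
    determines its law ([joint_law_unique]).  Bounds on [sigma] for all copulas
    are proved by cases on whether some law has the given distribution function;
    in the negative case [sigma] is identically [0] ([sigma_default]). *)

Local Notation plane R := (measurableTypeR R * measurableTypeR R)%type.

(** * Copulas and the family [C_r] *)

Ltac minmax_free t :=
  lazymatch t with
  | context [Order.min _ _] => fail
  | context [Order.max _ _] => fail
  | _ => idtac
  end.

(** Splits on innermost occurrences first: comparing arguments that still
    contain a minimum or a maximum would create hypotheses opaque to [lra]. *)
Ltac minmax_lra :=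
  repeat match goal with
  | |- context [Order.min ?a ?b] =>
      minmax_free a; minmax_free b; case: (leP a b) => ?
  | |- context [Order.max ?a ?b] =>
      minmax_free a; minmax_free b; case: (leP a b) => ?
  end; lra.

Section copula_r.
Context {R : realType}.
Implicit Types (r u v : R) (C : R -> R -> R).

(** Splitting each variable at [r] into a lower part [min u r] and an upper part
    [max (u - r) 0] turns the case distinction into the sum of an
    antimonotone term in the lower parts and a comonotone term in the upper
    parts, and each term is visibly 2-increasing. *)
Lemma copula_rE r u v : 0 <= r -> 0 <= u -> 0 <= v ->
  copula_r r u v = Num.max (Num.min u r + Num.min v r - r) 0
                   + Num.min (Num.max (u - r) 0) (Num.max (v - r) 0).
Proof.
move=> r0 u0 v0; rewrite /copula_r u0 v0 /=.
by case: (leP u r) => ur; case: (leP v r) => vr /=; minmax_lra.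
Qed.

(** A convex function of the sum of two variables is supermodular. *)
Lemma max0_supermodular (a1 a2 b1 b2 : R) : a1 <= a2 -> b1 <= b2 ->
  Num.max (a1 + b2) 0 + Num.max (a2 + b1) 0
    <= Num.max (a2 + b2) 0 + Num.max (a1 + b1) 0.
Proof.
by move=> ? ?; minmax_lra.
Qed.

Lemma min_supermodular (a1 a2 b1 b2 : R) : a1 <= a2 -> b1 <= b2 ->
  Num.min a1 b2 + Num.min a2 b1 <= Num.min a2 b2 + Num.min a1 b1.
Proof.
by move=> ? ?; minmax_lra.
Qed.

Lemma copula_r_is_copula r : 0 <= r <= 1 -> is_copula (copula_r r).
Proof.
move=> /andP[r0 r1]; split.
- move=> u v /andP[u0 u1] /andP[v0 v1]; rewrite /copula_r u0 v0 /=.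
  by case: ifPn => [/andP[? ?]|_]; minmax_lra.
- move=> a /andP[a0 a1]; rewrite /copula_r.
  by split; case: ifPn => [/andP[/andP[? ?] /andP[? ?]]|_]; minmax_lra.
- move=> a /andP[a0 a1]; rewrite /copula_r.
  by split; case: ifPn => [/andP[/andP[? ?] /andP[? ?]]|_]; minmax_lra.
- move=> a1 a2 b1 b2 a1_0 a12 a21 b1_0 b12 b21.
  have a20 := le_trans a1_0 a12; have b20 := le_trans b1_0 b12.
  rewrite !copula_rE//.
  have clampD p q : p <= q -> Num.min p r <= Num.min q r /\
      Num.max (p - r) 0 <= Num.max (q - r) 0.
    by move=> pq; split; minmax_lra.
  have [ma Ma] := clampD _ _ a12; have [mb Mb] := clampD _ _ b12.
  have mb' : Num.min b1 r - r <= Num.min b2 r - r by rewrite lerD2r.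
  have := max0_supermodular ma mb'; rewrite !addrA.
  by have := min_supermodular Ma Mb; lra.
Qed.

(** The Frechet bounds all come from applying the 2-increasing property to a
    rectangle with a side on the boundary of the unit square. *)
Lemma copula_le_left C a b : is_copula C -> 0 <= a <= 1 -> 0 <= b <= 1 ->
  C a b <= a.
Proof.
move=> [_ C0 C1 C2] a01 /andP[b0 b1]; have /andP[a0 a1] := a01.
have := C2 _ _ _ _ (lexx 0) a0 a1 b0 b1 (lexx 1).
have [Ca1 _] := C1 _ a01.
have [_ C01] := C0 1 ltac:(by rewrite ler01 lexx).
have [_ C0b] := C0 b ltac:(by rewrite b0 b1).
lra.
Qed.

Lemma copula_le_right C a b : is_copula C -> 0 <= a <= 1 -> 0 <= b <= 1 ->
  C a b <= b.
Proof.
move=> [_ C0 C1 C2] /andP[a0 a1] b01; have /andP[b0 b1] := b01.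
have := C2 _ _ _ _ a0 a1 (lexx 1) (lexx 0) b0 b1.
have [_ C1b] := C1 _ b01.
have [C10 _] := C0 1 ltac:(by rewrite ler01 lexx).
have [Ca0 _] := C0 a ltac:(by rewrite a0 a1).
lra.
Qed.

Lemma copula_ge C a b : is_copula C -> 0 <= a <= 1 -> 0 <= b <= 1 ->
  a + b - 1 <= C a b.
Proof.
move=> [_ _ C1 C2] a01 b01; have /andP[a0 a1] := a01; have /andP[b0 b1] := b01.
have := C2 _ _ _ _ a0 a1 (lexx 1) b0 b1 (lexx 1).
have [Ca1 _] := C1 _ a01; have [_ C1b] := C1 _ b01.
have [C11 _] := C1 1 ltac:(by rewrite ler01 lexx).
lra.
Qed.
End copula_r.

(** * Left limits of nondecreasing functions *)

Section left_limit.
Context {R : realType} (f : R -> R).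
Hypothesis ndf : {homo f : x y / x <= y}.

Let cvg_left z : cvg (f x @[x --> z^'-]).
Proof.
apply: nondecreasing_at_left_is_cvgr; near=> x.
  by move=> ? ? _ _; exact: ndf.
by exists (f z) => _ /= [y + <-]; rewrite in_itv => /= /andP[_ /ltW/ndf].
Unshelve. all: by end_near. Qed.

(** Together with the next lemma, this says that the left limit at [z] is the
    supremum of the values before [z]. *)
Lemma left_limit_ge x z : x < z -> f x <= left_limit f z.
Proof.
move=> xz; apply: limr_ge; first exact: cvg_left.
by near=> y; apply/ndf/ltW; near: y; exact: nbhs_left_gt.
Unshelve. all: by end_near. Qed.

Lemma left_limit_le z M : (forall x, x < z -> f x <= M) -> left_limit f z <= M.
Proof.
move=> fM; apply: limr_le; first exact: cvg_left.
by near=> y; apply/fM; near: y; exact: nbhs_left_lt.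
Unshelve. all: by end_near. Qed.

End left_limit.

(** * Distribution functions and their quantiles *)

Section df.
Context {R : realType} (F : cumulativeBounded (0 : R) (1 : R)).

Lemma df_homo : {homo F : x y / x <= y}.
Proof. exact: cumulative_is_nondecreasing. Qed.

Lemma df01 x : 0 <= F x <= 1.
Proof.
apply/andP; split.
  apply: (cvgr_to_le (cumulativeNy F)); near=> y; apply: df_homo; near: y.
  exact: nbhs_ninfty_le.
apply: (cvgr_to_ge (cumulativey F)); near=> y; apply: df_homo; near: y.
exact: nbhs_pinfty_ge.
Unshelve. all: by end_near. Qed.

Lemma df_near1 u : u < 1 -> exists x, u <= F x.
Proof.
move=> u1; have /(_ _ u u1) := cvgr_ge _ (cumulativey F).
by move=> [M [_ MP]]; exists (M + 1); apply: MP; rewrite ltrDl.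
Qed.

Lemma df_near0 u : 0 < u -> exists x, F x < u.
Proof.
move=> u0; have /(_ _ u u0) := cvgr_lt _ (cumulativeNy F).
by move=> [M [_ MP]]; exists (M - 1); apply: MP; rewrite ltrBlDr ltrDl.
Qed.

Lemma df_right_ge u x : (forall y, x < y -> u <= F y) -> u <= F x.
Proof.
move=> uF; apply: (cvgr_to_ge (cumulative_is_right_continuous F x)).
by near=> y; apply: uF; near: y; exact: nbhs_right_gt.
Unshelve. all: by end_near. Qed.

Definition quantile u := inf [set x | u <= F x].

(** Right-continuity of [F] makes the infimum attained, so that the quantile is
    the left adjoint of [F].  The restriction to the open interval is essential:
    at the ends the infimum may range over an empty or unbounded set. *)
Lemma quantile_le u x : 0 < u < 1 -> (quantile u <= x) = (u <= F x).
Proof.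
move=> /andP[/df_near0[l Fl] /df_near1[m um]].
have lbF : has_lbound [set x | u <= F x].
  exists l => y /= uFy; rewrite leNgt; apply/negP => /ltW/df_homo.
  by lra.
apply/idP/idP => [qx|uFx]; last exact: ge_inf.
apply: df_right_ge => y xy.
have /inf_lt : inf [set x | u <= F x] < y by exact: le_lt_trans xy.
by move=> /(_ (ex_intro _ m um))[t /= uFt /ltW/df_homo]; exact: le_trans.
Qed.

Lemma measurable_quantile : measurable_fun (`]0, 1[ : set R) quantile.
Proof.
apply: (measurability _ (RGenOInfty.measurableE R)) => _ [_ [x ->] <-].
rewrite (_ : _ `&` _ = `]0, 1[ `&` `]F x, +oo[)//; first exact: measurableI.
apply/seteqP; split => u [/= u01]; have := u01;
    rewrite !in_itv/= !andbT => {}u01.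
  by rewrite ltNge quantile_le// -ltNge.
by rewrite ltNge -quantile_le// -ltNge.
Qed.

End df.

(** * Laws on the plane *)

Section joint_law.
Context {R : realType}.
Implicit Types mu nu : joint_law R.

Lemma measurable_quadrant (x y : R) :
  measurable (`]-oo, x] `*` `]-oo, y] : set (plane R)).
Proof. by apply: measurableX; exact: measurable_itv. Qed.

Lemma measurable_sum_le (z : R) :
  measurable (sum_le z : set (plane R)).
Proof.
rewrite (_ : sum_le z =
  setT `&` (fun p => p.1 + p.2) @^-1` `]-oo, z]); last first.
  by apply/seteqP; split => p; rewrite /sum_le /= in_itv/=; [split|case].
have : measurable_fun setT
    (fun p : plane R => p.1 + p.2).
  by apply: measurable_funD; [exact: measurable_fst|exact: measurable_snd].
by apply => //; exact: measurable_itv.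
Qed.

Lemma sum_lt_bigcup (z : R) : sum_lt z = \bigcup_n sum_le (z - n.+1%:R^-1).
Proof.
apply/seteqP; split => [p pz|p [n _]]; rewrite /sum_le/sum_lt/=; last first.
  by move=> /le_lt_trans; apply; rewrite ltrBlDr ltrDl invr_gt0.
have pz0 : 0 < z - (p.1 + p.2) by rewrite subr_gt0.
have [n _ /(_ n (leqnn n))/= h] := near_infty_natSinv_lt (PosNum pz0).
exists n => //; by rewrite /sum_le/= lerBrDr addrC -lerBrDr ltW.
Qed.

Lemma measurable_sum_lt (z : R) :
  measurable (sum_lt z : set (plane R)).
Proof.
rewrite sum_lt_bigcup; apply: bigcupT_measurable => n.
exact: measurable_sum_le.
Qed.

Lemma sum_le_lt mu (x z : R) : x < z -> (mu (sum_le x) <= mu (sum_lt z))%E.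
Proof.
move=> xz; apply: le_measure; rewrite ?inE.
- exact: measurable_sum_le.
- exact: measurable_sum_lt.
- by move=> p /le_lt_trans; exact.
Qed.

Lemma sum_le_homo mu (x z : R) : x <= z -> (mu (sum_le x) <= mu (sum_le z))%E.
Proof.
move=> xz; apply: le_measure; rewrite ?inE; try exact: measurable_sum_le.
by move=> p /le_trans; exact.
Qed.

(** Continuity from below along the half-planes [x + y <= z - 1/(n+1)]. *)
Lemma sum_lt_le mu (z : R) (M : \bar R) :
  (forall x, x < z -> (mu (sum_le x) <= M)%E) -> (mu (sum_lt z) <= M)%E.
Proof.
move=> muM; rewrite sum_lt_bigcup.
have mle n : measurable (sum_le (z - n.+1%:R^-1)
  : set (plane R)) by exact: measurable_sum_le.
have nd : nondecreasing_seq (fun n => sum_le (z - n.+1%:R^-1)).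
  move=> m n mn; apply/subsetPset => p; rewrite /sum_le/= => /le_trans; apply.
  by rewrite lerB// lef_pV2 ?posrE// ler_nat.
have /cvg_lim <- // := nondecreasing_cvg_mu (mu := mu) mle
   (bigcupT_measurable _ mle) nd.
apply: lime_le; last by near=> n; apply: muM; rewrite ltrBlDr ltrDl invr_gt0.
apply: ereal_nondecreasing_is_cvgn => m n mn; apply: sum_le_homo.
by rewrite lerB// lef_pV2 ?posrE// ler_nat.
Unshelve. all: by end_near. Qed.

Lemma bigcup_measureE mu (A : nat -> set (R * R)) (c : nat -> R) (l : R) :
  (forall n, measurable (A n : set (plane R))) ->
  nondecreasing_seq A -> (forall n, mu (A n) = (c n)%:E) ->
  c n @[n --> \oo] --> l ->
  mu (\bigcup_n A n) = l%:E.
Proof.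
move=> mA ndA muA cl.
have := nondecreasing_cvg_mu (mu := mu) mA (bigcupT_measurable _ mA) ndA.
move/cvg_unique; apply=> //.
rewrite (_ : _ \o _ = EFin \o c); last by apply/funext => n; exact: muA.
by apply: cvg_EFin => //; near=> n.
Unshelve. all: by end_near. Qed.

(** Quadrants form a pi-system that generates the Borel sets of the plane. *)
Lemma joint_law_unique mu nu :
  (forall x y, mu (`]-oo, x] `*` `]-oo, y]) = nu (`]-oo, x] `*` `]-oo, y])) ->
  forall A, measurable A -> mu A = nu A.
Proof.
move=> munu.
pose Q : set (set (plane R)) :=
  [set `]-oo, p.1] `*` `]-oo, p.2] | p in [set: R * R]].
have QI : setI_closed Q.
  move=> _ _ [[a b] _ <-] [[c d] _ <-].
  exists (Num.min a c, Num.min b d) => //=.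
  rewrite -setXI; congr (_ `*` _); apply/seteqP; split => x /=;
    by rewrite !in_itv/= le_min => /andP.
have Qgen : @measurable _ (plane R) = <<s Q >>.
  apply/seteqP; split; last first.
    apply: smallest_sub; first exact: sigma_algebra_measurable.
    by move=> _ [p _ <-]; exact: measurable_quadrant.
  (* Open right half-lines generate the Borel sets of the line, so it suffices
     that the half-planes they define come from quadrants. *)
  have quadrants_fst x : fst @^-1` `]x, +oo[ =
      ~` \bigcup_n (`]-oo, x] `*` `]-oo, n%:R]) :> set (R * R).
    apply/seteqP; split => [[a b]|[a b]] /=; rewrite in_itv/= andbT => ax.
      by move=> [n _ []] /=; rewrite in_itv/= leNgt ax.
    rewrite ltNge; apply/negP => xa; apply: ax; exists (Num.truncn b).+1 => //.
    by split; rewrite /= in_itv//= ltW// truncnS_gt.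
  have quadrants_snd x : snd @^-1` `]x, +oo[ =
      ~` \bigcup_n (`]-oo, n%:R] `*` `]-oo, x]) :> set (R * R).
    apply/seteqP; split => [[a b]|[a b]] /=; rewrite in_itv/= andbT => ax.
      by move=> [n _ []] /=; rewrite !in_itv/= => _; rewrite leNgt ax.
    rewrite ltNge; apply/negP => xa; apply: ax; exists (Num.truncn a).+1 => //.
    by split; rewrite /= in_itv//= ltW// truncnS_gt.
  have mfst : measurable_fun setT (fst : g_sigma_algebraType Q -> R).
    apply: (measurability _ (RGenOInfty.measurableE R)) => _ [_ [x ->] <-].
    rewrite setTI quadrants_fst; apply/measurableC/bigcupT_measurable => n.
    by apply: sub_sigma_algebra; exists (x, n%:R).
  have msnd : measurable_fun setT (snd : g_sigma_algebraType Q -> R).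
    apply: (measurability _ (RGenOInfty.measurableE R)) => _ [_ [x ->] <-].
    rewrite setTI quadrants_snd; apply/measurableC/bigcupT_measurable => n.
    by apply: sub_sigma_algebra; exists (n%:R, x).
  apply: smallest_sub; first exact: smallest_sigma_algebra.
  rewrite subUset; split => _ [A mA <-].
    exact: (mfst measurableT A mA).
  exact: (msnd measurableT A mA).
move=> A mA.
have TQ : \bigcup_n (`]-oo, n%:R] `*` `]-oo, n%:R]) = [set: R * R].
  apply/seteqP; split => // -[a b] _.
  exists (Num.truncn (Num.max a b)).+1 => //; split; rewrite /= in_itv/= ltW//.
    by rewrite (le_lt_trans _ (truncnS_gt _))// le_max lexx.
  by rewrite (le_lt_trans _ (truncnS_gt _))// le_max lexx orbT.
apply: (measure_unique Q (fun n => `]-oo, n%:R] `*` `]-oo, n%:R])) => //.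
- by move=> n; exists (n%:R, n%:R).
- by move=> _ [p _ <-]; exact: munu.
- move=> n; rewrite (le_lt_trans (probability_le1 mu _)) ?ltry//.
  exact: measurable_quadrant.
Qed.

End joint_law.

(** * The Makarov bound is an upper bound *)

Section bounds.
Context {R : realType} (F G : cumulativeBounded (0 : R) (1 : R)).
Implicit Types (mu : joint_law R) (C : R -> R -> R) (x y z : R).

(** Letting [y] tend to infinity in [C (F x) (G y)] requires continuity of [C]
    at the side [v = 1]; it follows from the Frechet bounds
    [u + v - 1 <= C u v <= u], which squeeze the limit.  The side [u = 1] is
    symmetric. *)
Lemma copula_has_margins C mu : is_copula C ->
  has_joint_df mu (fun x y => C (F x) (G y)) -> has_margins mu F G.
Proof.
move=> copC muC; split=> [x|y].
- have -> : `]-oo, x] `*` setT = \bigcup_n (`]-oo, x] `*` `]-oo, n%:R])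
      :> set (R * R).
    apply/seteqP; split => [[a b] [/= ax _]|[a b] [n _ [/= ax _]]//].
    exists (Num.truncn b).+1 => //; split => //=.
    by rewrite in_itv/= ltW// truncnS_gt.
  apply: (bigcup_measureE (c := fun n => C (F x) (G n%:R))) => [n|m n mn|n|].
  + exact: measurable_quadrant.
  + apply/subsetPset => -[a b] [] /= ? bm; split => //=.
    by move: bm; rewrite !in_itv/= => /le_trans; apply; rewrite ler_nat.
  + exact: muC.
  apply: (@squeeze_cvgr _ _ _ _ (fun n => F x + G n%:R - 1) (cst (F x))).
  + by near=> n; rewrite copula_ge ?df01// copula_le_left ?df01.
  + rewrite -[X in _ --> X](addrK 1); apply: cvgB; last exact: cvg_cst.
    apply: cvgD; first exact: cvg_cst.
    exact: (cvg_comp _ _ (@cvgr_idn R) (cumulativey G)).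
  + exact: cvg_cst.
- have -> : setT `*` `]-oo, y] = \bigcup_n (`]-oo, n%:R] `*` `]-oo, y])
      :> set (R * R).
    apply/seteqP; split => [[a b] [/= _ bx]|[a b] [n _ [/= _ bx]]//].
    exists (Num.truncn a).+1 => //; split => //=.
    by rewrite in_itv/= ltW// truncnS_gt.
  apply: (bigcup_measureE (c := fun n => C (F n%:R) (G y))) => [n|m n mn|n|].
  + exact: measurable_quadrant.
  + apply/subsetPset => -[a b] [] /= am ?; split => //=.
    by move: am; rewrite !in_itv/= => /le_trans; apply; rewrite ler_nat.
  + exact: muC.
  apply: (@squeeze_cvgr _ _ _ _ (fun n => F n%:R + G y - 1) (cst (G y))).
  + by near=> n; rewrite copula_ge ?df01// copula_le_right ?df01.
  + rewrite [X in _ --> X](_ : _ = 1 + G y - 1); last by rewrite addrC addKr.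
    apply: cvgB; last exact: cvg_cst.
    apply: cvgD; last exact: cvg_cst.
    exact: (cvg_comp _ _ (@cvgr_idn R) (cumulativey F)).
  + exact: cvg_cst.
Unshelve. all: by end_near. Qed.

Let rho_set z :=
  [set t : R | exists x y, x + y = z /\ t = Num.min 1 (F x + G y)].

Let lb_rho_set z : lbound (rho_set z) 0.
Proof.
move=> _ [x [y [_ ->]]]; rewrite le_min ler01/=.
by have /andP[? _] := df01 F x; have /andP[? _] := df01 G y; exact: addr_ge0.
Qed.

Lemma rho_W_le x z : rho_W F G z <= Num.min 1 (F x + G (z - x)).
Proof.
apply: ge_inf; first by exists 0; exact: lb_rho_set.
by exists x, (z - x); rewrite addrC subrK.
Qed.

Lemma rho_W_leD x y z : x + y = z -> rho_W F G z <= F x + G y.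
Proof.
move=> <-; have := rho_W_le x (x + y); rewrite (addrC x) addrK le_min.
by move=> /andP[].
Qed.

Lemma rho_W_ge M z : M <= 1 -> (forall x y, x + y = z -> M <= F x + G y) ->
  M <= rho_W F G z.
Proof.
move=> M1 MFG; apply: lb_le_inf.
  by exists (Num.min 1 (F 0 + G z)), 0, z; rewrite add0r.
by move=> _ [x [y [xyz ->]]]; rewrite le_min M1 MFG.
Qed.

Lemma rho_W01 z : 0 <= rho_W F G z <= 1.
Proof.
apply/andP; split.
  apply: rho_W_ge => // x y _.
  by have /andP[? _] := df01 F x; have /andP[? _] := df01 G y; exact: addr_ge0.
by have := rho_W_le 0 z; rewrite le_min => /andP[].
Qed.

Lemma rho_W_homo : {homo rho_W F G : x z / x <= z}.
Proof.
move=> z1 z2 z12; have /andP[_ le1] := rho_W01 z1.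
apply: rho_W_ge => // x y xyz; apply: (le_trans (@rho_W_leD x (z1 - x) z1 _)).
  by rewrite addrC subrK.
by rewrite lerD2l; apply: df_homo; rewrite lerBlDl xyz.
Qed.

(** If [a + b <= z = x + y] then [a <= x] or [b <= y]. *)
Lemma sum_le_rho_W mu z : has_margins mu F G ->
  (mu (sum_le z) <= (rho_W F G z)%:E)%E.
Proof.
move=> [muF muG].
have mle1 : (mu (sum_le z) <= 1)%E.
  by apply: probability_le1; exact: measurable_sum_le.
have muE : mu (sum_le z) = (fine (mu (sum_le z)))%:E.
  by rewrite fineK// fin_num_measure//; exact: measurable_sum_le.
rewrite muE lee_fin; apply: rho_W_ge => [|x y xyz].
  by rewrite -lee_fin -muE.
rewrite -lee_fin -muE EFinD -muF -muG.
have mF : measurable (`]-oo, x] `*` setT : set (plane R)).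
  by apply: measurableX => //; exact: measurable_itv.
have mG : measurable (setT `*` `]-oo, y] : set (plane R)).
  by apply: measurableX => //; exact: measurable_itv.
apply: le_trans (measureU2 mu mF mG); apply: le_measure; rewrite ?inE.
- exact: measurable_sum_le.
- exact: measurableU.
- move=> [a b]; rewrite /sum_le/= => abz.
  have [ax|xa] := leP a x; first by left; split; rewrite //= in_itv.
  by right; split => //=; rewrite in_itv/=; lra.
Qed.

Lemma sum_lt_rho_W mu z : has_margins mu F G ->
  (mu (sum_lt z) <= (left_limit (rho_W F G) z)%:E)%E.
Proof.
move=> muFG; apply: sum_lt_le => x xz; apply: (le_trans (sum_le_rho_W _ muFG)).
by rewrite lee_fin; apply: left_limit_ge => //; exact: rho_W_homo.
Qed.

Lemma sigmaE C mu z : has_joint_df mu (fun x y => C (F x) (G y)) ->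
  (sigma C F G z)%:E = mu (sum_le z).
Proof.
move=> muC; rewrite /sigma; case: xgetP => [_ _ [nu nuC <-]|none].
  apply: joint_law_unique => [x y|]; last exact: measurable_sum_le.
  by rewrite nuC muC.
exfalso; apply: (none (fine (mu (sum_le z)))); exists mu => //.
by rewrite fineK// fin_num_measure//; exact: measurable_sum_le.
Qed.

(** The alternative to [sigmaE] in the proofs by cases of [sigma_homo] and
    [sigma_le_rho_W]. *)
Lemma sigma_default C z :
  ~ (exists mu, has_joint_df mu (fun x y => C (F x) (G y))) ->
  sigma C F G z = 0.
Proof.
by move=> none; rewrite /sigma xgetPN// => _ [mu muC _]; apply: none; exists mu.
Qed.

Lemma sigma_homo C : {homo sigma C F G : x z / x <= z}.
Proof.
move=> x z xz.
have [[mu muC]|none] := pselect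
  (exists mu : joint_law R, has_joint_df mu (fun x y => C (F x) (G y))).
  by rewrite -lee_fin !(sigmaE _ muC); exact: sum_le_homo.
by rewrite !sigma_default.
Qed.

Lemma sigma_le_rho_W C z : is_copula C -> sigma C F G z <= rho_W F G z.
Proof.
move=> copC.
have [[mu muC]|none] := pselect
  (exists mu : joint_law R, has_joint_df mu (fun x y => C (F x) (G y))).
  rewrite -lee_fin (sigmaE _ muC); apply: sum_le_rho_W.
  exact: copula_has_margins muC.
by rewrite sigma_default//; have /andP[] := rho_W01 z.
Qed.

Lemma left_limit_sigma_le C z : is_copula C ->
  left_limit (sigma C F G) z <= left_limit (rho_W F G) z.
Proof.
move=> copC; apply: left_limit_le => [|x xz]; first exact: sigma_homo.
apply: (le_trans (sigma_le_rho_W _ copC)).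
by apply: left_limit_ge => //; exact: rho_W_homo.
Qed.

Lemma left_limit_sigmaE C mu z : has_joint_df mu (fun x y => C (F x) (G y)) ->
  (left_limit (sigma C F G) z)%:E = mu (sum_lt z).
Proof.
move=> muC; apply/eqP; rewrite eq_le; apply/andP; split; last first.
  apply: sum_lt_le => x xz; rewrite -(sigmaE _ muC) lee_fin.
  by apply: left_limit_ge => //; exact: sigma_homo.
have muE : mu (sum_lt z) = (fine (mu (sum_lt z)))%:E.
  by rewrite fineK// fin_num_measure//; exact: measurable_sum_lt.
rewrite muE lee_fin; apply: left_limit_le => [|x xz]; first exact: sigma_homo.
by rewrite -lee_fin -muE (sigmaE _ muC); exact: sum_le_lt.
Qed.

Lemma left_limit_rho_W_le z : left_limit (rho_W F G) z <= rho_W F G z.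
Proof. by apply: left_limit_le => [|x /ltW]; exact: rho_W_homo. Qed.

Lemma left_limit_rho_W01 z : 0 <= left_limit (rho_W F G) z <= 1.
Proof.
have /andP[_ r1] := rho_W01 z.
have /andP[r0 _] := rho_W01 (z - 1).
rewrite (le_trans (left_limit_rho_W_le z) r1) andbT (le_trans r0)//.
by apply: left_limit_ge; [exact: rho_W_homo|rewrite ltrBlDr ltrDl].
Qed.

End bounds.

(** * Uniform measure on the unit interval *)

Section uniform01.
Context {R : realType}.

Definition unif01 : probability (measurableTypeR R) R :=
  uniform_prob (@ltr01 R).

Lemma unif01E (A : set R) : measurable A ->
  unif01 A = lebesgue_measure (A `&` `[0, 1]).
Proof.
move=> mA; rewrite /unif01 /= /uniform_prob integral_uniform_pdf.
rewrite (eq_integral (cst 1%E)); last first.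
  move=> x; rewrite inE /= in_itv/= => -[_ x01].
  by rewrite /uniform_pdf x01 subr0 invr1.
by rewrite integral_cst ?mul1e//; exact: measurableI.
Qed.

Lemma unif01_itvoc (a b : R) : 0 <= a -> b <= 1 ->
  unif01 `]a, b]%classic = (Num.max (b - a) 0)%:E.
Proof.
move=> a0 b1; rewrite unif01E//.
have -> : `]a, b] `&` `[0, 1] = `]a, b]%classic.
  by apply/seteqP; split => x /=; rewrite !in_itv/=; [case|lra].
rewrite lebesgue_measure_itv/= lte_fin; case: ltP => ab.
  by rewrite max_l// subr_ge0 ltW.
by rewrite max_r// subr_le0.
Qed.

(** Comparison of events up to a countable set [N] and the two ends of the unit
    interval, where quantiles are meaningless. *)
Lemma le_unif01 (N A B : set R) : countable N -> measurable A -> measurable B ->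
  (forall u, 0 < u < 1 -> ~ N u -> A u -> B u) -> (unif01 A <= unif01 B)%E.
Proof.
move=> cN mA mB AB; pose N' := N `|` [set 0; 1].
have cN' : countable N'.
  rewrite /N' -bigcup2E; apply: bigcup_countable => // -[|[|n]] _ //=.
  by apply/finite_set_countable; exact: finite_set2.
have mN' : measurable N' by exact: countable_measurable.
have nullN' : unif01 N' = 0%E.
  rewrite unif01E//; apply: countable_lebesgue_measure0.
  by apply: sub_countable cN'; exact: subset_card_le.
have subadd : (unif01 (B `|` N') <= unif01 B)%E.
  by rewrite -[leRHS]adde0 -nullN'; exact: measureU2.
apply: le_trans subadd; have mBN' : measurable (B `|` N') by exact: measurableU.
have {1}-> := unif01E mA; have -> := unif01E mBN'.
apply: le_measure; rewrite ?inE; do ?exact: measurableI.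
move=> u [Au u01]; split => //.
have [N'u|nN'u] := pselect (N' u); first by right.
left; apply: AB => //; last by move=> Nu; apply: nN'u; left.
have := u01; rewrite /= in_itv/= !le_eqVlt.
move=> /andP[/predU1P[u0|->]/= /predU1P[u1|->//]].
- by exfalso; apply: nN'u; right; left.
- by exfalso; apply: nN'u; right; left.
- by exfalso; apply: nN'u; right; right.
Qed.

Lemma unif01_eq_itv (N A : set R) (a b : R) : countable N -> measurable A ->
  0 <= a -> b <= 1 -> (forall u, 0 < u < 1 -> ~ N u -> A u <-> a < u <= b) ->
  unif01 A = (Num.max (b - a) 0)%:E.
Proof.
move=> cN mA a0 b1 Aab; rewrite -unif01_itvoc//; apply/eqP; rewrite eq_le.
by apply/andP; split; apply: (le_unif01 cN) => // u u01 Nu;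
  rewrite /= in_itv/= => ?; apply/Aab.
Qed.

(** Points at distance at least [d] from each other lie in different cells
    [n d <= u < (n + 1) d]. *)
Lemma separated_countable (A : set R) (d : R) : 0 < d ->
  (forall u v, A u -> A v -> u < v -> u + d <= v) -> countable A.
Proof.
move=> d0 sepA; apply/countable_injP.
exists (fun u => choice.pickle (Num.floor (u / d))) => u v.
rewrite !inE => Au Av.
move=> /(pcan_inj choice.pickleK) uv.
wlog ltuv : u v Au Av uv / u < v.
  move=> wl; case: (ltgtP u v) => // [|vu]; first exact: wl.
  by apply/esym; exact: wl.
have : u / d + 1 <= v / d.
  by rewrite -(divff (lt0r_neq0 d0)) -mulrDl ler_pM2r ?invr_gt0 ?sepA.
have := floor_le (u / d); have := floorD1_gt (v / d).
by rewrite -uv intrD; lra.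
Qed.

End uniform01.

(** * The coupling with copula [C_r] *)

Section coupling.
Context {R : realType} (F G : cumulativeBounded (0 : R) (1 : R)) (r : R).
Hypothesis r01 : 0 <= r <= 1.

(** A measure-preserving map of the unit interval: for uniform [u], the pair
    [(u, flip u)] has the copula [C_r] as its distribution function. *)
Definition flip (u : R) := if u < r then r - u else u.

Lemma flip_itv u : 0 < u < 1 -> 0 < flip u < 1.
Proof. by move: r01; rewrite /flip; case: (ltP u r) => ur; lra. Qed.

(* The quantiles are set to 0 outside the open unit interval, where their
   infimum is not controlled, so as to be measurable on the whole line. *)
Let X : R -> R := quantile F \_ `]0, 1[.
Let Y : R -> R := (quantile G \_ `]0, 1[) \o flip.

Let XE u : 0 < u < 1 -> X u = quantile F u.
Proof. by move=> u01; rewrite /X patchE mem_set//= in_itv. Qed.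

Let YE u : 0 < u < 1 -> Y u = quantile G (flip u).
Proof. by move=> u01; rewrite /Y/= patchE mem_set//= in_itv/= flip_itv. Qed.

Let mX : measurable_fun setT X.
Proof.
apply/(measurable_restrictT _ _).1 => //; exact: measurable_quantile.
Qed.

Let mY : measurable_fun setT Y.
Proof.
apply: measurableT_comp.
  by apply/(measurable_restrictT _ _).1 => //; exact: measurable_quantile.
apply: measurable_fun_ifT => //; first exact: measurable_fun_ltr.
exact: measurable_funB.
Qed.

Let XY : measurableTypeR R -> plane R :=
  fun u => (X u, Y u).

Let mXY : measurable_fun setT XY.
Proof. exact: measurable_fun_pair. Qed.

HB.instance Definition _ := isMeasurableFun.Build _ _ _ _ XY mXY.

Definition copula_r_law : joint_law R := distribution unif01 XY.

Lemma copula_r_lawE A : copula_r_law A = unif01 (XY @^-1` A).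
Proof. by []. Qed.

(** By the adjunction [quantile_le], the event [X <= x, Y <= y] is
    [u <= F x, flip u <= G y], which is an interval of length
    [C_r (F x) (G y)] up to the points [r] and [r - G y]. *)
Lemma copula_r_law_joint_df :
  has_joint_df copula_r_law (fun x y => copula_r r (F x) (G y)).
Proof.
move=> x y; rewrite copula_r_lawE.
set A := _ @^-1` _; set a := F x; set b := G y.
have mA : measurable A.
  by rewrite -[A]setTI; apply: mXY => //; exact: measurable_quadrant.
have AE u : 0 < u < 1 -> A u <-> u <= a /\ flip u <= b.
  by move=> u01; rewrite /A/= !in_itv/= XE// YE// !quantile_le// flip_itv.
have a01 : 0 <= a <= 1 by exact: df01.
have b01 : 0 <= b <= 1 by exact: df01.
have cN : countable [set r; r - b].
  by apply/finite_set_countable; exact: finite_set2.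
have outN u : ~ [set r; r - b] u -> u != r /\ u != r - b.
  by move=> Nu; split; apply/eqP => uE; apply: Nu; [left|right].
have r01' := r01.
(* If [r < b], the constraint on [flip u] only says [u <= b]; if [b <= r], it
   says that [u] lies between [r - b] and [r]. *)
have [rb|br] := ltP r b.
  rewrite (unif01_eq_itv (a := 0) (b := Num.min a b) cN mA) => //.
  - rewrite /copula_r; case: ifPn => [/andP[_ ?]|_]; first by exfalso; lra.
    by congr EFin; minmax_lra.
  - by minmax_lra.
  - move=> u u01 /outN[ur urb]; rewrite AE// /flip le_min.
    by case: (ltP u r) => ?; split=> [[? ?]|/and3P[? ? ?]]; try split; lra.
have [ra|ar] := ltP r a.
  rewrite (unif01_eq_itv (a := r - b) (b := r) cN mA); [|lra|lra|].
  - rewrite /copula_r; case: ifPn => [/andP[? _]|_]; first by exfalso; lra.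
    by congr EFin; minmax_lra.
  - move=> u u01 /outN[]; rewrite AE// /flip !neq_lt.
    move=> /orP ur /orP urb.
    by case: (ltP u r) => ?; split=> [[? ?]|/andP[? ?]]; try split; lra.
rewrite (unif01_eq_itv (a := r - b) (b := a) cN mA); [|lra|lra|].
- rewrite /copula_r; case: ifPn => [_|/negP[]]; last by apply/andP; split; lra.
  by congr EFin; minmax_lra.
- move=> u u01 /outN[]; rewrite AE// /flip !neq_lt => /orP ur /orP urb.
  by case: (ltP u r) => ?; split=> [[? ?]|/andP[? ?]]; try split; lra.
Qed.

(** The only part of the law of use for lower bounds is the antimonotone one,
    carried by the [u] in ]0,r[, which has mass exactly [r]. *)
Lemma copula_r_law_ge (N : set R) (S : set (R * R)) : countable N ->
  measurable (S : set (plane R)) ->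
  (forall u, 0 < u < r -> ~ N u -> S (quantile F u, quantile G (r - u))) ->
  (r%:E <= copula_r_law S)%E.
Proof.
move=> cN mS NS; rewrite copula_r_lawE.
have /andP[r0 r1] := r01.
have r0r : unif01 `]0, r]%classic = r%:E by rewrite unif01_itvoc// subr0 max_l.
rewrite -r0r; have cN' : countable (N `|` [set r]).
  rewrite -bigcup2E; apply: bigcup_countable => // -[|[|n]] _ //=.
apply: (le_unif01 cN') => //.
  by rewrite -[X in measurable X]setTI; apply: mXY.
move=> u u01 Nu; rewrite /= in_itv/= => /andP[u0 ur].
have {}ur : u < r.
  by rewrite lt_neqAle ur andbT; apply/eqP => ur'; apply: Nu; right.
rewrite /preimage/= /XY XE// YE// /flip ur; apply: NS; first by rewrite u0.
by move=> nu; apply: Nu; left.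
Qed.

End coupling.

(** * Attainment of the bounds *)

Section attained.
Context {R : realType} (F G : cumulativeBounded (0 : R) (1 : R)).
Implicit Types (u x y z : R).

(** With [r = rho_W F G z], right-continuity of [G] turns the inequality
    [r - u < G (z - x)], valid for all [x < quantile F u], into
    [r - u <= G (z - quantile F u)]. *)
Lemma quantile_sum_le z u : 0 < u < rho_W F G z ->
  quantile F u + quantile G (rho_W F G z - u) <= z.
Proof.
have /andP[_ r1] := rho_W01 F G z => /andP[u0 ur].
rewrite -lerBrDl quantile_le; last by lra.
apply: df_right_ge => y qy.
have Fu : F (z - y) < u.
  by rewrite ltNge -quantile_le -?ltNge; lra.
have := @rho_W_leD _ F G (z - y) y z (subrK _ _); lra.
Qed.

Lemma copula_r_law_attains z :
  copula_r_law F G (rho_W F G z) (sum_le z) = (rho_W F G z)%:E.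
Proof.
have r01 := rho_W01 F G z.
apply/eqP; rewrite eq_le; apply/andP; split.
  apply: sum_le_rho_W; apply: copula_has_margins (copula_r_is_copula r01) _.
  exact: copula_r_law_joint_df.
apply: (copula_r_law_ge r01 (N := set0)) => //; first exact: measurable_sum_le.
by move=> u ur _; exact: quantile_sum_le.
Qed.

Section jump.
Context (z : R).
Let s := rho_W F G z.
Let r := left_limit (rho_W F G) z.
(* The parameters at which the coupling misses the event [X + Y < z]. *)
Let bad := [set u | 0 < u < r /\ z <= quantile F u + quantile G (r - u)].

Let r1 : r <= 1.
Proof. by have /andP[] := left_limit_rho_W01 F G z. Qed.

Let bad_F u x : bad u -> x < quantile F u -> F x < u.
Proof.
move=> [/andP[u0 ur] _]; rewrite ltNge quantile_le -?ltNge//.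
by have := r1; lra.
Qed.

Let bad_G u y : bad u -> y < z - quantile F u -> G y < r - u.
Proof.
move=> [/andP[u0 ur] bu] yz; have := r1 => r1'.
by rewrite ltNge -quantile_le -?ltNge; lra.
Qed.

(* Just to the right of [x = quantile F u], the value [G (z - x)] stays below
   [r - u] while [F x + G (z - x)] is at least [s]. *)
Let bad_jump u : bad u -> u + (s - r) <= F (quantile F u).
Proof.
move=> bu; apply: df_right_ge => x qx.
have Gx : G (z - x) < r - u by apply: bad_G => //; lra.
have := @rho_W_leD _ F G x (z - x) z ltac:(by rewrite addrC subrK).
rewrite -/s; lra.
Qed.

(* Two bad parameters [u < v] closer than [s - r] would share the quantile
   [x = quantile F u], by [bad_jump].  Left of [x] the values of [F] are below
   [u], and left of [z - x] those of [G] are below [r - v]; so [rho_W F G] would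
   stay below [r - (v - u)] before [z], against the definition of [r]. *)
Let bad_separated u v : bad u -> bad v -> u < v -> u + (s - r) <= v.
Proof.
move=> bu bv uv; rewrite leNgt; apply/negP => vu.
have [[/andP[u0 ur] _] [/andP[v0 vr] _]] := (bu, bv).
have := r1 => r1'.
have qvu : quantile F v <= quantile F u.
  by rewrite quantile_le; [have := bad_jump bu; lra|lra].
suff : r <= r - (v - u) by lra.
apply: left_limit_le => [|w wz]; first exact: rho_W_homo.
(* Split the gap [z - w] evenly between the two variables. *)
pose e := (z - w) / 2.
have Fx : F (quantile F u - e) < u by apply: bad_F => //; rewrite /e; lra.
have Gy : G (z - quantile F u - e) < r - v.
  by apply: bad_G => //; rewrite /e; lra.
have := @rho_W_leD _ F G (quantile F u - e) (z - quantile F u - e) w.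
rewrite /e => /(_ ltac:(lra)); rewrite -/e; lra.
Qed.

Lemma copula_r_law_attains_left : r < s ->
  copula_r_law F G r (sum_lt z) = r%:E.
Proof.
move=> rs; have r01 := left_limit_rho_W01 F G z.
apply/eqP; rewrite eq_le; apply/andP; split.
  apply: sum_lt_rho_W; apply: copula_has_margins (copula_r_is_copula r01) _.
  exact: copula_r_law_joint_df.
have cbad : countable bad.
  apply: (@separated_countable _ _ (s - r)); first by rewrite subr_gt0.
  exact: bad_separated.
apply: (copula_r_law_ge r01 cbad); first exact: measurable_sum_lt.
move=> u ur nbad; rewrite /sum_lt/= ltNge; apply/negP => h; exact: nbad.
Qed.

End jump.
End attained.

Theorem theorem24 (R : realType) (F G : cumulativeBounded (0 : R) (1 : R))
    (z : R) :
  let r := rho_W F G z in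
  let rstar := left_limit (rho_W F G) z in
  (* (i) *)
  ([/\ 0 <= r <= 1,
       is_copula (copula_r r),
       sigma (copula_r r) F G z = r,
       forall mu : joint_law R,
         has_margins mu F G -> (mu (sum_le z) <= r%:E)%E
     & exists mu : joint_law R,
         [/\ has_margins mu F G,
             has_joint_df mu (fun x y => copula_r r (F x) (G y))
           & mu (sum_le z) = r%:E] ])
  /\
  (* (ii) *)
  (rstar = sup [set left_limit (sigma C F G) z | C in @is_copula R] /\
   rstar%:E =
     ereal_sup [set mu (sum_lt z) | mu in [set mu : joint_law R |
                                            has_margins mu F G]])
  /\
  (* (iii) *)
  ((rstar < r ->
     [/\ 0 <= rstar <= 1,
         is_copula (copula_r rstar),
         left_limit (sigma (copula_r rstar) F G) z = rstar
       & exists mu : joint_law R,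
           [/\ has_margins mu F G,
               has_joint_df mu (fun x y => copula_r rstar (F x) (G y))
             & mu (sum_lt z) = rstar%:E] ]) /\
   (exists2 C, is_copula C & sigma C F G z = r) /\
   (forall C, is_copula C -> sigma C F G z <= r))
  /\
  (* (iv) *)
  ((~ (exists2 C, is_copula C & left_limit (sigma C F G) z = rstar) ->
     r = rstar) /\
   (~ (exists2 mu : joint_law R,
         has_margins mu F G & mu (sum_lt z) = rstar%:E) ->
     r = rstar)).
Proof.
move=> r rstar.
have r01 := rho_W01 F G z; have rstar01 := left_limit_rho_W01 F G z.
have law_df s : 0 <= s <= 1 -> has_joint_df (copula_r_law F G s)
    (fun x y => copula_r s (F x) (G y)) by exact: copula_r_law_joint_df.
have law_margins s : 0 <= s <= 1 -> has_margins (copula_r_law F G s) F G.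
  move=> s01; apply: copula_has_margins (copula_r_is_copula s01) _.
  exact: law_df.
have sigma_r x : sigma (copula_r (rho_W F G x)) F G x = rho_W F G x.
  apply: EFin_inj; rewrite (sigmaE _ (law_df _ (rho_W01 F G x))).
  exact: copula_r_law_attains.
have attained_left : rstar < r -> [/\ 0 <= rstar <= 1,
     is_copula (copula_r rstar),
     left_limit (sigma (copula_r rstar) F G) z = rstar
   & exists mu : joint_law R, [/\ has_margins mu F G,
       has_joint_df mu (fun x y => copula_r rstar (F x) (G y))
     & mu (sum_lt z) = rstar%:E] ].
  move=> jump; split=> //.
  - exact: copula_r_is_copula.
  - apply: EFin_inj; rewrite (left_limit_sigmaE _ (law_df _ rstar01)).
    exact: copula_r_law_attains_left.
  - exists (copula_r_law F G rstar); split; [exact: law_margins|exact: law_df|].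
    exact: copula_r_law_attains_left.
have no_jump : ~ rstar < r -> r = rstar.
  by move=> /negP; rewrite -leNgt => rr; apply/eqP;
     rewrite eq_le rr left_limit_rho_W_le.
split; [|split; [|split]].
- split=> //.
  + exact: copula_r_is_copula.
  + exact: sigma_r.
  + by move=> mu; exact: sum_le_rho_W.
  + exists (copula_r_law F G r); split; [exact: law_margins|exact: law_df|].
    exact: copula_r_law_attains.
- split.
    apply/eqP; rewrite eq_le; apply/andP; split; last first.
      apply: ge_sup => [|_ [C copC <-]]; last exact: left_limit_sigma_le.
      exists (left_limit (sigma (copula_r r) F G) z), (copula_r r) => //.
      exact: copula_r_is_copula.
    apply: left_limit_le => [|x xz]; first exact: rho_W_homo.
    rewrite -sigma_r; apply: (le_trans (left_limit_ge _ xz)).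
      exact: sigma_homo.
    apply: ub_le_sup.
      by exists rstar => _ [C copC <-]; exact: left_limit_sigma_le.
    exists (copula_r (rho_W F G x)) => //.
    by apply: copula_r_is_copula; exact: rho_W01.
  apply/eqP; rewrite eq_le; apply/andP; split; last first.
    by apply: ge_ereal_sup => _ [mu muFG <-]; exact: sum_lt_rho_W.
  set e := ereal_sup _.
  have rho_e x : x < z -> ((rho_W F G x)%:E <= e)%E.
    move=> xz; rewrite -copula_r_law_attains.
    apply: (le_trans (sum_le_lt _ xz)); apply: ereal_sup_ubound.
    exists (copula_r_law F G (rho_W F G x)) => //.
    by apply: law_margins; exact: rho_W01.
  (* The supremum is a priori an extended real; the left limit can be bounded
     only once it is known to be finite. *)
  move: rho_e; case: e => [e||] rho_e; last 2 first.
  + by rewrite leey.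
  + by have := rho_e (z - 1); rewrite ltrBlDr ltrDl => /(_ ltr01).
  rewrite lee_fin; apply: left_limit_le => [|x xz]; first exact: rho_W_homo.
  by rewrite -lee_fin rho_e.
- split=> //; split; last by move=> C; exact: sigma_le_rho_W.
  by exists (copula_r r); [exact: copula_r_is_copula|exact: sigma_r].
- split=> none; apply: no_jump;
    move=> /attained_left[_ copC sigmaC [mu [muFG _ muz]]]; apply: none;
    [by exists (copula_r rstar)|by exists mu].
Qed.
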